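(* Let $\hat{\bm x}$ be the penalized maximum likelihood estimator with regularization parameters $\rho_1,\rho_2\ge0$, $\hat M = M(\hat{\bm x})$, and $L$ the average Kullback-Leibler loss, in the multi-relational network model described in the context. Let the number of entities $N \to \infty$ and let $C, K, U, d_E, d_R, \alpha, \gamma$ be absolute constants (not depending on $N$). Assume that $\bm x^* \in \Theta = \mathcal{E}^N \times \mathcal{R}^K$, where $\mathcal{E}$ and $\mathcal{R}$ are Euclidean balls of radius $U$ centered at $\bm 0$; that $|\phi(\bm u) - \phi(\bm v)| \le \alpha \|\bm u - \bm v\|$ for all $\bm u, \bm v \in \mathcal{E}^2 \times \mathcal{R}$; and that $\rho_1+\rho_2 = o(\log N)$. Then: (i) When $t > 0$ is a fixed constant, $$\log P\big(L(\hat M, M^* ) \geq t\big) \lesssim - \frac{t}{5C}\, n.$$ (ii) When $t = 10C \frac{m}{n} \log \frac{n}{m}$, $$\log P\big(L(\hat M, M^* ) \geq t\big) \lesssim - m \log \frac{n}{m}.$$ (iii) Furthermore, $$E\big[L(\hat M, M^* )\big] \lesssim 10C\, \frac{m}{n} \log \frac{n}{m}.$$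
   Context: Notation: $[N]=\{1,\dots,N\}$; $\sigma(x) = e^x/(1+e^x)$; $D(p\|q) = p\log\frac{p}{q} + (1-p)\log\frac{1-p}{1-q}$ is the Kullback-Leibler divergence between Bernoulli$(p)$ and Bernoulli$(q)$; $\|\cdot\|$ is the Euclidean norm and $\|\cdot\|_1$ the $L_1$ norm. For positive sequences, $a \lesssim b$ means $\limsup_{N\to\infty} a/b \le 1$; for negative sequences, $a \lesssim b$ means $\liminf_{N\to\infty} a/b \ge 1$. Model: There are $N$ entities and $K$ relations; $\Lambda = [N]\times[N]\times[K]$ is the set of edges. $\mathcal{E}\subset\mathbb{R}^{d_E}$ and $\mathcal{R}\subset\mathbb{R}^{d_R}$ are compact sets, $\Theta = \mathcal{E}^N\times\mathcal{R}^K$, and elements of $\Theta$ are written $\bm x = (\bm\theta_1,\dots,\bm\theta_N,\bm w_1,\dots,\bm w_K)$. For $\lambda=(i,j,k)\in\Lambda$ put $\bm x_\lambda = (\bm\theta_i,\bm\theta_j,\bm w_k)$. Given a score function $\phi:\mathcal{E}^2\times\mathcal{R}\to\mathbb{R}$, let $M_\lambda(\bm x) = \sigma(\phi(\bm x_\lambda))$ and $M(\bm x) = (M_\lambda(\bm x))_{\lambda\in\Lambda}$. The true parameter is $\bm x^*$, $M^* = M(\bm x^* )$, and the $Y_\lambda$, $\lambda\in\Lambda$, are independent Bernoulli$(M^*_\lambda)$ variables. Each edge is observed independently with probability $\gamma\in(0,1]$, independently of $Y$; $\mathcal{S}\subset\Lambda$ is the random set of observed edges. Put $n = \gamma N^2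 K$, $m = N d_E + K d_R$, and $C = \sup_{\bm u\in\mathcal{E}^2\times\mathcal{R}}|\phi(\bm u)|$; it is assumed throughout that $C\ge 2$. Estimator: the log-likelihood is $l(\bm x;Y_{\mathcal{S}}) = \sum_{\lambda\in\mathcal{S}} \big[Y_\lambda\log M_\lambda(\bm x) + (1-Y_\lambda)\log(1-M_\lambda(\bm x))\big]$ and the penalized log-likelihood is $l_\rho(\bm x;Y_{\mathcal{S}}) = l(\bm x;Y_{\mathcal{S}}) - \rho_1\|\bm x\|_1 - \rho_2\|\bm x\|^2$, where $\rho_1,\rho_2\ge 0$ may depend on $N$. The penalized maximum likelihood estimator $\hat{\bm x}$ is a maximizer of $l_\rho(\bm x;Y_{\mathcal{S}})$ over $\bm x\in\Theta$ (not necessarily unique). Loss: $L(\hat M,M^* ) = \frac{1}{|\Lambda|}\sum_{\lambda\in\Lambda} D(M^*_\lambda\|\hat M_\lambda)$. *)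

(* Defs.v *)
From HB Require Import structures.
From mathcomp Require Import all_boot all_order all_algebra.
From mathcomp Require Import all_classical all_reals all_analysis.

Set Implicit Arguments.
Unset Strict Implicit.
Unset Printing Implicit Defensive.

Import Order.TTheory GRing.Theory Num.Theory.
Import numFieldNormedType.Exports.

Local Open Scope classical_set_scope.
Local Open Scope ring_scope.

Section asymptotic_comparison.
Context {R : realType}.

(* The left-hand side is extended-real valued because it may be [lne 0 = -oo];
   for [b N < 0] the ratio [-oo * (b N)^-1] is then [+oo]. *)
Definition lesssim_pos (a : nat -> \bar R) (b : nat -> R) : Prop :=
  (limn_esup (fun N => a N * (b N)^-1%:E) <= 1)%E.

Definition lesssim_neg (a : nat -> \bar R) (b : nat -> R) : Prop :=
  (1 <= limn_einf (fun N => a N * (b N)^-1%:E))%E.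

End asymptotic_comparison.

Section scalar_functions.
Context {R : realType}.

Definition sigmoid (x : R) : R := expR x / (1 + expR x).

Definition KL (p q : R) : R :=
  p * ln (p / q) + (1 - p) * ln ((1 - p) / (1 - q)).

(* The library norm [`|u|] on matrices is the max norm. *)
Definition enorm (d : nat) (u : 'rV[R]_d) : R :=
  Num.sqrt (\sum_(j < d) u ord0 j ^+ 2).

Definition l1norm (d : nat) (u : 'rV[R]_d) : R := \sum_(j < d) `|u ord0 j|.

Definition eball (d : nat) (U : R) : set 'rV[R]_d := [set u | enorm u <= U].

End scalar_functions.

Section independence.
Context {R : realType} {d : measure_display} {T : measurableType d}.
Variable P : probability T R.

Definition mutually_independent {d'} {T' : measurableType d'} (I : finType)
    (X : I -> {RV P >-> T'}) : Prop :=
  forall (J : {set I}) (B : I -> set T'), (forall i, measurable (B i)) ->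
    (P (\bigcap_(i in [set` J]) X i @^-1` B i)
     = \prod_(i in J) P (X i @^-1` B i))%E.

(* [I -> bool] is finite, so every set of values is an event. *)
Definition independent_vectors (I : finType) (X Z : I -> {RV P >-> bool}) :
    Prop :=
  forall A B : set (I -> bool),
    (P ([set w | A (fun i => X i w)] `&` [set w | B (fun i => Z i w)])
     = P [set w | A (fun i => X i w)] * P [set w | B (fun i => Z i w)])%E.

End independence.

Section model.
Context {R : realType} (N K dE dR : nat).

Definition edge : finType := ('I_N * 'I_N * 'I_K)%type.

Record param : Type := Param {
  theta : 'I_N -> 'rV[R]_dE ;
  relw : 'I_K -> 'rV[R]_dR }.

Definition Theta (U : R) : set param :=
  [set x | (forall i, eball U (theta x i)) /\ (forall k, eball U (relw x k))].

(* E^2 x R, as a subset of R^(dE + dE + dR) *)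
Definition triples (U : R) : set 'rV[R]_(dE + dE + dR) :=
  [set u | exists a b c, [/\ eball U a, eball U b, eball U c
                           & u = row_mx (row_mx a b) c]].

Definition at_edge (x : param) (e : edge) : 'rV[R]_(dE + dE + dR) :=
  row_mx (row_mx (theta x e.1.1) (theta x e.1.2)) (relw x e.2).

Variable phi : 'rV[R]_(dE + dE + dR) -> R.

Definition Mprob (x : param) (e : edge) : R := sigmoid (phi (at_edge x e)).

Definition loglik (y : edge -> bool) (S : {set edge}) (x : param) : R :=
  \sum_(e in S) ((y e)%:R * ln (Mprob x e) + (1 - (y e)%:R) * ln (1 - Mprob x e)).

Definition param_l1norm (x : param) : R :=
  \sum_(i < N) l1norm (theta x i) + \sum_(k < K) l1norm (relw x k).

Definition param_enorm (x : param) : R :=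
  Num.sqrt (\sum_(i < N) enorm (theta x i) ^+ 2
            + \sum_(k < K) enorm (relw x k) ^+ 2).

Definition penloglik (rho1 rho2 : R) (y : edge -> bool) (S : {set edge})
    (x : param) : R :=
  loglik y S x - rho1 * param_l1norm x - rho2 * param_enorm x ^+ 2.

Definition is_PMLE (U rho1 rho2 : R) (y : edge -> bool) (S : {set edge})
    (xhat : param) : Prop :=
  Theta U xhat /\
  forall x, Theta U x -> penloglik rho1 rho2 y S x <= penloglik rho1 rho2 y S xhat.

Definition KLloss (xhat xstar : param) : R :=
  (#|edge|%:R)^-1 * \sum_(e : edge) KL (Mprob xstar e) (Mprob xhat e).

Context {d : measure_display} {T : measurableType d}.

(* [Obs e] indicates that the edge [e] is observed. *)
Record network_model (P : probability T R) (gamma : R) (xstar : param)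
    (Y Obs : edge -> {RV P >-> bool}) : Prop := NetworkModel {
  Y_bernoulli : forall e, distribution P (Y e) =1 bernoulli_prob (Mprob xstar e) ;
  Y_independent : mutually_independent Y ;
  Obs_bernoulli : forall e, distribution P (Obs e) =1 bernoulli_prob gamma ;
  Obs_independent : mutually_independent Obs ;
  Y_Obs_independent : independent_vectors Y Obs }.

Definition observed (P : probability T R) (Obs : edge -> {RV P >-> bool})
    (w : T) : {set edge} := [set e | Obs e w]%SET.

End model.

Definition eff_sample_size {R : realType} (gamma : R) (K N : nat) : R :=
  gamma * N%:R ^+ 2 * K%:R.

Definition num_params (K dE dR N : nat) : nat := (N * dE + K * dR)%N.

(* Main.v *)
Require Import Defs.
From HB Require Import structures.
From mathcomp Require Import all_boot all_order all_algebra.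
From mathcomp Require Import all_classical all_reals all_analysis.
From mathcomp Require Import measurable_realfun ring lra.

(* For a fixed parameter [x], Markov's inequality applied to the square root of
   the likelihood ratio of [x] against [xstar] bounds the probability that the
   ratio is not small by [exp (- gamma * sum of (1 - affinity))], and the
   divergence is at most [2 * (2 + C) <= 4 * C] times [1 - affinity]. A union
   bound over a grid with [O (n / m)] points for each of the [m] coordinates
   costs a factor [exp (m * ln (n / m) + O (m))], and the discretisation and the
   penalty cost only [exp (o (m * ln (n / m)))]. Hence eventually
     [P (L >= t) <= exp (3/2 * m * ln (n / m) - n * t / (4 * C))]
   for all [t >= 0]; the gap between [4 * C] and [5 * C] absorbs the first term
   in (i), and in (ii) the exponent is exactly [- m * ln (n / m)]. Part (iii)
   follows since the loss is bounded by [2 * C]. *)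

Set Implicit Arguments.
Unset Strict Implicit.
Unset Printing Implicit Defensive.

Import Order.TTheory GRing.Theory Num.Theory.
Import numFieldNormedType.Exports.

Local Open Scope classical_set_scope.
Local Open Scope ring_scope.

(** * Divergence against squared Hellinger distance for Bernoulli laws *)

Section scalar_inequalities.
Context {R : realType}.
Implicit Types a b c p q x y s : R.

(** By the mean value theorem: the derivative [expR x + expR (- x)] is at least [2]. *)
Lemma le_sinh s : 0 <= s -> 2 * s <= expR s - expR (- s).
Proof.
rewrite le_eqVlt => /predU1P[<-|s0]; first by rewrite oppr0 subrr mulr0.
pose f x : R := expR x - expR (- x).
pose f' x : R := expR x + expR (- x).
have df x : is_derive x (1:R) f (f' x).
  by apply: is_derive_eq; rewrite /f' /GRing.scale/=; ring.
have [|c _] := MVT s0 (fun x _ => df x).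
  apply: derivable_within_continuous => x _.
  by have := df x => -[].
rewrite /f oppr0 subrr !subr0 => ->; rewrite addr0 ler_pM2r// /f'.
rewrite expRN; have e0 := expR_gt0 c; move: (expR c) e0 => u u0.
rewrite -subr_ge0; have -> : u + u^-1 - 2 = (u - 1) ^+ 2 / u by field; lra.
by rewrite divr_ge0 ?sqr_ge0// ltW.
Qed.

Lemma ln_le_half_sub_inv y : 1 <= y -> 2 * ln y <= y - y^-1.
Proof.
move=> y1; have y0 : 0 < y by lra.
by have := le_sinh (ln_ge0 y1); rewrite expRN lnK.
Qed.

(** Here [y] stands for the root of [p / q]. For [y <= 1], the bound [ln y <= y - 1] leaves
    [(2 * y + 1) * (y - 1) ^+ 2], whence the constant [3]. For [y > 1], the bound
    [2 * ln y <= y - y^-1] is used, and the final slack is [(y - 1) ^+ 3 / y]. *)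
Lemma entropy_le_sqr c y : 3 <= c -> 0 < y -> 2 * ln y + 2 <= c ->
  2 * y ^+ 2 * ln y - y ^+ 2 + 1 <= c * (y - 1) ^+ 2.
Proof.
move=> c3 y0 hc; have [y1|y1] := leP y 1.
  have lny : ln y <= y - 1.
    by have := @le_ln1Dx R (y - 1); rewrite [1 + _]addrC subrK; apply; lra.
  apply: (@le_trans _ _ (2 * y ^+ 2 * (y - 1) - y ^+ 2 + 1)).
    by rewrite lerD2r lerD2r ler_wpM2l// mulr_ge0// sqr_ge0.
  apply: (@le_trans _ _ (3 * (y - 1) ^+ 2)); last first.
    by rewrite ler_wpM2r// sqr_ge0.
  by have := sqr_ge0 (y - 1); nra.
have lny := ln_le_half_sub_inv (ltW y1).
apply: (@le_trans _ _ ((2 * ln y + 2) * (y - 1) ^+ 2)); last first.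
  by rewrite ler_wpM2r// sqr_ge0.
have h : 2 * ln y * (2 * y - 1) <= (y - y^-1) * (2 * y - 1).
  by rewrite ler_pM2r//; lra.
suff : (y - y^-1) * (2 * y - 1) <= 3 * y ^+ 2 - 4 * y + 1 by nra.
rewrite -subr_ge0.
have -> : 3 * y ^+ 2 - 4 * y + 1 - (y - y^-1) * (2 * y - 1) =
  (y - 1) ^+ 3 / y by field; lra.
by rewrite divr_ge0 ?exprn_ge0//; lra.
Qed.

(** The previous inequality at the root of [p / q], multiplied by [q]. The terms [- p + q] make it
    valid for each outcome separately; they cancel once both outcomes are added. *)
Lemma entropy_le_hellinger c p q : 3 <= c -> 0 < p -> 0 < q ->
  ln (p / q) + 2 <= c ->
  p * ln (p / q) - p + q <= c * (Num.sqrt p - Num.sqrt q) ^+ 2.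
Proof.
move=> c3 p0 q0 hc.
have sp0 : 0 < Num.sqrt p by rewrite sqrtr_gt0.
have sq0 : 0 < Num.sqrt q by rewrite sqrtr_gt0.
pose y := Num.sqrt p / Num.sqrt q.
have y0 : 0 < y by rewrite divr_gt0.
have y2 : y ^+ 2 = p / q by rewrite exprMn exprVn !sqr_sqrtr// ltW.
have lny : ln (p / q) = 2 * ln y by rewrite -y2 lnXn// mulr_natl.
have hy := entropy_le_sqr c3 y0; rewrite -lny in hy.
have /(ler_wpM2l (ltW q0)) := hy hc.
congr (_ <= _).
  rewrite y2 (_ : 2 * (p / q) * ln y = (p / q) * (2 * ln y)); last by ring.
  by rewrite -lny; field; lra.
rewrite mulrCA; congr (_ * _).
rewrite -[X in X * _](@sqr_sqrtr _ q) ?ltW// -exprMn; congr (_ ^+ 2).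
by rewrite /y mulrBr mulr1 mulrCA divff ?mulr1// gt_eqF.
Qed.

(** The Bhattacharyya coefficient of the two Bernoulli laws; [1 - affinity p q] is half the sum of
    the squared differences of the roots of the probabilities. *)
Definition affinity p q : R :=
  Num.sqrt p * Num.sqrt q + Num.sqrt (1 - p) * Num.sqrt (1 - q).

(* The bound of Yang and Barron: as the log-likelihood ratios are at most [c],
   the divergence is at most [2 + c] times the squared Hellinger distance. *)
Lemma KL_le_affinity c p q : 1 <= c -> 0 < p < 1 -> 0 < q < 1 ->
  ln (p / q) <= c -> ln ((1 - p) / (1 - q)) <= c ->
  KL p q <= 2 * (2 + c) * (1 - affinity p q).
Proof.
move=> c1 /andP[p0 p1] /andP[q0 q1] hp hq.
have h1 : p * ln (p / q) - p + q <= (2 + c) * (Num.sqrt p - Num.sqrt q) ^+ 2.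
  by apply: entropy_le_hellinger => //; lra.
have h2 : (1 - p) * ln ((1 - p) / (1 - q)) - (1 - p) + (1 - q) <=
    (2 + c) * (Num.sqrt (1 - p) - Num.sqrt (1 - q)) ^+ 2.
  by apply: entropy_le_hellinger; lra.
have := lerD h1 h2; congr (_ <= _).
  by rewrite /KL; ring.
rewrite -mulrDr [2 * _]mulrC -mulrA; congr (_ * _).
by rewrite !sqrrB !sqr_sqrtr /affinity; lra.
Qed.

Lemma expR_half_ln p : 0 < p -> expR (ln p / 2) = Num.sqrt p.
Proof.
by move=> p0; rewrite -powR12_sqrt ?ltW// /powR gt_eqF// mulrC.
Qed.

(** The contribution of one outcome to the expected root of the likelihood ratio, hence one summand
    of [affinity]. *)
Lemma mul_expR_half_ln p q : 0 < p -> 0 < q ->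
  p * expR ((ln q - ln p) / 2) = Num.sqrt p * Num.sqrt q.
Proof.
move=> p0 q0; rewrite mulrBl expRB !expR_half_ln//.
rewrite -[X in X * _](@sqr_sqrtr _ p) ?ltW//; field.
by rewrite gt_eqF// sqrtr_gt0.
Qed.

End scalar_inequalities.

(** * Logistic link: Lipschitz bounds for log-probabilities and divergences *)

Section sigmoid.
Context {R : realType}.
Implicit Types a b c e p u v x : R.

Lemma sigmoid_gt0 x : 0 < sigmoid x.
Proof. by rewrite divr_gt0 ?addr_gt0 ?expR_gt0. Qed.

Lemma onem_sigmoid x : 1 - sigmoid x = sigmoid (- x).
Proof.
rewrite /sigmoid expRN; have := expR_gt0 x; move: (expR x) => u u0.
by field; lra.
Qed.

Lemma sigmoid_itv x : 0 < sigmoid x < 1.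
Proof.
by rewrite sigmoid_gt0/= -subr_gt0 onem_sigmoid sigmoid_gt0.
Qed.

(** The lower bound is monotonicity. For the upper bound, the numerator of [sigmoid] gains the
    factor [expR (b - a)] while the denominator only grows. *)
Lemma ln_sigmoidB_itv a b : a <= b ->
  0 <= ln (sigmoid b) - ln (sigmoid a) <= b - a.
Proof.
move=> ab; have ab' : expR a <= expR b by rewrite ler_expR.
have a0 := expR_gt0 a; have b0 := expR_gt0 b.
rewrite subr_ge0 ler_ln ?posrE ?sigmoid_gt0//; apply/andP; split.
  rewrite ler_pdivrMr ?addr_gt0// mulrAC ler_pdivlMr ?addr_gt0//.
  by rewrite !mulrDr !mulr1 [expR a * _]mulrC lerD2r.
rewrite lerBlDr -[X in X + _](expRK (b - a)) -lnM ?posrE ?expR_gt0 ?sigmoid_gt0//.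
rewrite ler_ln ?posrE ?mulr_gt0 ?expR_gt0 ?sigmoid_gt0// expRB /sigmoid.
rewrite mulrA divfK ?gt_eqF// ler_wpM2l ?expR_ge0//.
by rewrite lef_pV2 ?posrE ?addr_gt0// lerD2l.
Qed.

Lemma ln_sigmoid_lip a b : `|ln (sigmoid a) - ln (sigmoid b)| <= `|a - b|.
Proof.
wlog ab : a b / a <= b => [hwlog|].
  by have [/hwlog//|/ltW/hwlog] := leP a b; rewrite distrC [leRHS]distrC.
have /andP[h1 h2] := ln_sigmoidB_itv ab.
by rewrite distrC [leRHS]distrC !ger0_norm// subr_ge0.
Qed.

Lemma conv_norm_le p u v e : 0 <= p <= 1 -> `|u| <= e -> `|v| <= e ->
  `|p * u + (1 - p) * v| <= e.
Proof.
move=> /andP[p0 p1]; rewrite !ler_norml => /andP[u1 u2] /andP[v1 v2].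
by apply/andP; split; nra.
Qed.

(** The difference is an average, with weights [p] and [1 - p], of increments of the logarithm of
    [sigmoid] between [a] and [b] and between [- a] and [- b]. *)
Lemma KL_sigmoid_lip p a b : 0 < p < 1 ->
  `|KL p (sigmoid a) - KL p (sigmoid b)| <= `|a - b|.
Proof.
move=> /andP[p0 p1].
have -> : KL p (sigmoid a) - KL p (sigmoid b) =
    p * (ln (sigmoid b) - ln (sigmoid a)) +
    (1 - p) * (ln (sigmoid (- b)) - ln (sigmoid (- a))).
  rewrite /KL !onem_sigmoid !ln_div ?posrE ?subr_gt0 ?sigmoid_gt0 ?expR_gt0//.
  ring.
apply: conv_norm_le; first by lra.
  by rewrite [leRHS]distrC ln_sigmoid_lip.
by rewrite (le_trans (ln_sigmoid_lip _ _))// opprK addrC.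
Qed.

Lemma KL_id p : 0 < p < 1 -> KL p p = 0.
Proof.
move=> /andP[p0 p1]; rewrite /KL !divff ?ln1 ?mulr0 ?addr0//.
  by rewrite gt_eqF// subr_gt0.
by rewrite gt_eqF.
Qed.

(** From [ln (1 + x) <= x], the two terms are at least [p - q] and [q - p], which add up to [0]. *)
Lemma KL_ge0 p q : 0 < p < 1 -> 0 < q < 1 -> 0 <= KL p q.
Proof.
have aux x y : 0 < x -> 0 < y -> x - y <= x * ln (x / y).
  move=> x0 y0; rewrite -[_ / _]invf_div lnV ?posrE ?divr_gt0//.
  have := @le_ln1Dx _ (y / x - 1); rewrite [1 + _]addrC subrK => h.
  rewrite mulrN -opprB lerN2 -ler_pdivlMl// (le_trans (h _))//.
    by rewrite ltrBrDl subrr divr_gt0.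
  by rewrite mulrBr mulVf ?gt_eqF// mulrC.
move=> /andP[p0 p1] /andP[q0 q1]; have h1 := aux p q p0 q0.
have := aux (1 - p) (1 - q); rewrite /KL; lra.
Qed.

(** By monotonicity the extreme ratio is [sigmoid c / sigmoid (- c)], which is exactly [expR c]; so
    both log-ratios are at most [c], although the scores may differ by [2 * c]. *)
Lemma KL_sigmoid_le c a b : 1 <= c -> `|a| <= c -> `|b| <= c ->
  KL (sigmoid a) (sigmoid b) <=
  2 * (2 + c) * (1 - affinity (sigmoid a) (sigmoid b)).
Proof.
move=> c1; have aux x y : `|x| <= c -> `|y| <= c ->
    ln (sigmoid x / sigmoid y) <= c.
  rewrite !ler_norml => /andP[x1 x2] /andP[y1 y2].
  rewrite ln_div ?posrE ?sigmoid_gt0//.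
  have /andP[h1 h2] := ln_sigmoidB_itv x2.
  have /andP[h3 h4] := ln_sigmoidB_itv y1.
  suff : ln (sigmoid c) - ln (sigmoid (- c)) = c by lra.
  rewrite -[RHS]expRK -ln_div ?posrE ?sigmoid_gt0//; congr ln.
  rewrite /sigmoid expRN; have := expR_gt0 c; move: (expR c) => u u0.
  by field; rewrite !gt_eqF//; lra.
move=> ha hb; apply: KL_le_affinity; rewrite ?sigmoid_itv//.
  exact: aux.
by rewrite !onem_sigmoid aux// normrN.
Qed.

End sigmoid.

(** * Expected root of the likelihood ratio under the explicit law of the data *)

Section finite_law.
Context {R : realType} {I : finType}.
Implicit Types (g : R) (p q : I -> R) (z : {ffun I -> bool * bool}).

Definition joint_pmf g p z : R :=
  \prod_i (bernoulli_pmf (p i) (z i).1 * bernoulli_pmf g (z i).2).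

(** The second component of [z i] says whether [i] is observed. Only observed indices enter, and the
    observation probabilities cancel in the ratio. *)
Definition llr p q z : R :=
  \sum_(i | (z i).2)
    (ln (bernoulli_pmf (q i) (z i).1) - ln (bernoulli_pmf (p i) (z i).1)).

Lemma joint_pmf_ge0 g p z : 0 <= g <= 1 -> (forall i, 0 < p i < 1) ->
  0 <= joint_pmf g p z.
Proof.
move=> g01 p01; apply: prodr_ge0 => i _; rewrite mulr_ge0 ?bernoulli_pmf_ge0//.
by have /andP[/ltW-> /ltW->] := p01 i.
Qed.

(** The sum factors over the coordinates: each contributes [1] with weight [1 - g] when unobserved,
    and its affinity with weight [g] when observed. *)
Lemma sum_expR_half_llr g p q :
  (forall i, 0 < p i < 1) -> (forall i, 0 < q i < 1) ->
  \sum_z joint_pmf g p z * expR (llr p q z / 2) =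
  \prod_i (1 - g * (1 - affinity (p i) (q i))).
Proof.
move=> p01 q01.
pose F i (b : bool * bool) :=
  bernoulli_pmf (p i) b.1 * bernoulli_pmf g b.2 *
  expR (if b.2 then
    (ln (bernoulli_pmf (q i) b.1) - ln (bernoulli_pmf (p i) b.1)) / 2 else 0).
transitivity (\sum_(z : {ffun I -> bool * bool}) \prod_i F i (z i)).
  apply: eq_bigr => z _; rewrite big_split/= -expR_sum; congr (_ * expR _).
  by rewrite /llr mulr_suml big_mkcond.
rewrite -bigA_distr_bigA; apply: eq_bigr => i _.
rewrite -(pair_bigA _ (fun a b => F i (a, b)))/= !big_bool /F /= expR0.
have /andP[p0 p1] := p01 i; have /andP[q0 q1] := q01 i.
rewrite (mulrAC (p i)) (mulrAC (1 - p i)).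
rewrite !mul_expR_half_ln ?subr_gt0// /affinity; ring.
Qed.

(** Each factor is nonnegative and is bounded by [1 - x <= expR (- x)]. *)
Lemma sum_expR_half_llr_le g p q : 0 <= g <= 1 ->
  (forall i, 0 < p i < 1) -> (forall i, 0 < q i < 1) ->
  (forall i, affinity (p i) (q i) <= 1) ->
  \sum_z joint_pmf g p z * expR (llr p q z / 2) <=
  expR (- g * \sum_i (1 - affinity (p i) (q i))).
Proof.
move=> /andP[g0 g1] p01 q01 aff1.
rewrite sum_expR_half_llr// mulr_sumr expR_sum.
apply: ler_prod => i _; apply/andP; split; last first.
  by rewrite mulNr expR_ge1Dx.
have a0 : 0 <= affinity (p i) (q i) by rewrite addr_ge0// mulr_ge0// sqrtr_ge0.
by have := aff1 i; nra.
Qed.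

End finite_law.

(** * From the random variables to the explicit finite law *)

Section joint_law.
Context {R : realType} {d : measure_display} {T : measurableType d}.
Context {I : finType} (P : probability T R).
Implicit Types X Z : I -> {RV P >-> bool}.

Lemma preimage_vector X (b : I -> bool) :
  [set w | forall i, X i w = b i] =
  \bigcap_(i in [set` [set: I]%SET]) X i @^-1` [set b i].
Proof.
by apply/seteqP; split => w /= h i => [_|]; apply: h; rewrite /= inE.
Qed.

Lemma measurable_vector X (b : I -> bool) :
  measurable [set w | forall i, X i w = b i].
Proof.
rewrite preimage_vector; apply: fin_bigcap_measurable => //.
by move=> i _; rewrite -[_ @^-1` _]setTI; exact: measurable_funPT.
Qed.

Lemma bernoulli_vector X (p : I -> R) (b : I -> bool) :
  (forall i, 0 <= p i <= 1) ->
  (forall i, distribution P (X i) =1 bernoulli_prob (p i)) ->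
  mutually_independent X ->
  P [set w | forall i, X i w = b i] = (\prod_i bernoulli_pmf (p i) (b i))%:E.
Proof.
move=> p01 Xp indep; rewrite preimage_vector indep// -prodEFin.
apply: eq_big => [i|i _]; first by rewrite inE.
have := Xp i [set b i]; rewrite /distribution /pushforward => ->.
rewrite bernoulli_probE// !diracE.
by rewrite !classical_sets.in_set1; case: (b i); rewrite /= ?mule1 ?mule0 ?adde0 ?add0e.
Qed.

Lemma joint_vector X Z (g : R) (p : I -> R) (z : {ffun I -> bool * bool}) :
  0 <= g <= 1 -> (forall i, 0 <= p i <= 1) ->
  (forall i, distribution P (X i) =1 bernoulli_prob (p i)) ->
  mutually_independent X ->
  (forall i, distribution P (Z i) =1 bernoulli_prob g) ->
  mutually_independent Z -> independent_vectors X Z ->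
  P [set w | forall i, (X i w, Z i w) = z i] = (joint_pmf g p z)%:E.
Proof.
move=> g01 p01 Xp Xi Zg Zi XZ.
have -> : [set w | forall i, (X i w, Z i w) = z i] =
    [set w | [set x : I -> bool | forall i, x i = (z i).1] (fun i => X i w)] `&`
    [set w | [set x : I -> bool | forall i, x i = (z i).2] (fun i => Z i w)].
  apply/seteqP; split => w /=; first by move=> h; split => i; rewrite -h.
  by move=> [h1 h2] i; rewrite h1 h2 -surjective_pairing.
rewrite XZ (@bernoulli_vector _ p (fun i => (z i).1))//.
by rewrite (@bernoulli_vector _ (fun=> g) (fun i => (z i).2))// -EFinM -big_split.
Qed.

Lemma measurable_joint_vector X Z (z : I -> bool * bool) :
  measurable [set w | forall i, (X i w, Z i w) = z i].
Proof.
have -> : [set w | forall i, (X i w, Z i w) = z i] =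
    [set w | forall i, X i w = (z i).1] `&` [set w | forall i, Z i w = (z i).2].
  apply/seteqP; split => w /=; first by move=> h; split => i; rewrite -h.
  by move=> [h1 h2] i; rewrite h1 h2 -surjective_pairing.
by apply: measurableI; exact: measurable_vector.
Qed.

(** The event [E] may depend on the sample point beyond the values of [X] and [Z], as an estimator
    chosen among several maximizers may. It is therefore covered by the finitely many events that
    fix all these values, for outcomes in [A]. *)
Lemma measure_le_sum_joint X Z (g : R) (p : I -> R) (E : set T)
    (A : pred {ffun I -> bool * bool}) :
  0 <= g <= 1 -> (forall i, 0 <= p i <= 1) ->
  (forall i, distribution P (X i) =1 bernoulli_prob (p i)) ->
  mutually_independent X ->
  (forall i, distribution P (Z i) =1 bernoulli_prob g) ->
  mutually_independent Z -> independent_vectors X Z ->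
  measurable E -> (forall w, E w -> A [ffun i => (X i w, Z i w)]) ->
  (P E <= (\sum_(z | A z) joint_pmf g p z)%:E)%E.
Proof.
move=> g01 p01 Xp Xi Zg Zi XZ mE EA.
pose B (z : {ffun I -> bool * bool}) := [set w | forall i, (X i w, Z i w) = z i].
apply: (@le_trans _ _ (\sum_(z \in [set` A]) P (B z))%E).
  apply: content_sub_fsum => //.
    by move=> z _; exact: measurable_joint_vector.
  move=> w Ew; exists [ffun i => (X i w, Z i w)] => /=; first exact: EA.
  by move=> i; rewrite ffunE.
rewrite -(@bigfs _ _ _ _ (index_enum _) A) ?index_enum_uniq//; last first.
  by move=> z _; rewrite mem_index_enum.
by rewrite -sumEFin lee_sum// => z _; rewrite (joint_vector z g01 p01).
Qed.

End joint_law.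

(** * Tail of the loss for an abstract finite discretisation of the parameters *)

Section tail_bound.
Context {R : realType} {N K dE dR : nat}.
Variables (phi : 'rV[R]_(dE + dE + dR) -> R) (U C : R).
Hypothesis C1 : 1 <= C.
Hypothesis phi_le : forall u, triples U u -> `|phi u| <= C.
Implicit Types x : @param R N K dE dR.

Lemma triples_at_edge x e : Theta U x -> triples U (at_edge x e).
Proof.
move=> [h1 h2]; exists (theta x e.1.1), (theta x e.1.2), (relw x e.2).
by split.
Qed.

Lemma phi_at_edge_le x e : Theta U x -> `|phi (at_edge x e)| <= C.
Proof. by move=> /triples_at_edge/phi_le. Qed.

Lemma Mprob_itv x e : 0 < Mprob phi x e < 1.
Proof. exact: sigmoid_itv. Qed.

Lemma KLloss_ge0 x x' : 0 <= KLloss phi x x'.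
Proof.
rewrite mulr_ge0 ?invr_ge0// sumr_ge0// => e _.
by rewrite KL_ge0// Mprob_itv.
Qed.

(** Each divergence is [1]-Lipschitz in the score and vanishes at the true score, and two scores
    differ by at most [2 * C]. *)
Lemma KLloss_le x x' : Theta U x -> Theta U x' -> KLloss phi x x' <= 2 * C.
Proof.
(* Without edges the loss is [0], because [0^-1] is [0]. *)
move=> hx hx'; have [card0|card0] := eqVneq (#|edge N K|%:R : R) 0.
  by rewrite /KLloss card0 invr0 mul0r; have := C1; lra.
rewrite /KLloss ler_pdivrMl ?lt0r ?card0//=.
rewrite (_ : _ * (2 * C) = \sum_(e : edge N K) 2 * C); last first.
  by rewrite sumr_const -[RHS]mulr_natl.
apply: ler_sum => e _.
have h := KL_sigmoid_lip (phi (at_edge x e)) (phi (at_edge x' e)) (Mprob_itv x' e).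
have := le_trans (ler_norm _) h; rewrite (KL_id (Mprob_itv x' e)).
have := ler_normB (phi (at_edge x e)) (phi (at_edge x' e)).
have := phi_at_edge_le e hx; have := phi_at_edge_le e hx'; rewrite /Mprob; lra.
Qed.

Lemma KLloss_le_affinity x x' : Theta U x -> Theta U x' ->
  KLloss phi x x' * #|edge N K|%:R <=
  2 * (2 + C) * \sum_e (1 - affinity (Mprob phi x' e) (Mprob phi x e)).
Proof.
move=> hx hx'; rewrite /KLloss mulrAC.
have S0 : 0 <= \sum_e KL (Mprob phi x' e) (Mprob phi x e).
  by rewrite sumr_ge0// => e _; rewrite KL_ge0// Mprob_itv.
apply: (@le_trans _ _ (\sum_e KL (Mprob phi x' e) (Mprob phi x e))).
  have [->|c0] := eqVneq (#|edge N K|%:R : R) 0; first by rewrite mulr0 mul0r.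
  by rewrite mulVf// mul1r.
rewrite mulr_sumr; apply: ler_sum => e _.
by rewrite KL_sigmoid_le// phi_at_edge_le.
Qed.

(** A positive multiple of [1 - affinity] dominates a nonnegative divergence. *)
Lemma affinity_Mprob_le1 x x' e : Theta U x -> Theta U x' ->
  affinity (Mprob phi x' e) (Mprob phi x e) <= 1.
Proof.
move=> hx hx'.
have := KL_sigmoid_le C1 (phi_at_edge_le e hx') (phi_at_edge_le e hx).
have := KL_ge0 (Mprob_itv x' e) (Mprob_itv x e); rewrite /Mprob => h1 h2.
have := le_trans h1 h2; rewrite pmulr_rge0 ?subr_ge0//; have := C1; lra.
Qed.

Lemma loglikE y (S : {set edge N K}) x :
  loglik phi y S x = \sum_(e in S) ln (bernoulli_pmf (Mprob phi x e) (y e)).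
Proof.
apply: eq_bigr => e _; rewrite /bernoulli_pmf.
by case: (y e) => /=; ring.
Qed.

Lemma loglik_lip y (S : {set edge N K}) x x' eta : 0 <= eta ->
  (forall e, `|phi (at_edge x e) - phi (at_edge x' e)| <= eta) ->
  loglik phi y S x <= loglik phi y S x' + #|edge N K|%:R * eta.
Proof.
move=> eta0 h; rewrite -lerBlDl !loglikE -sumrB.
apply: (@le_trans _ _ (\sum_(e in S) eta)).
  apply: ler_sum => e _; apply: le_trans (ler_norm _) _.
  rewrite /Mprob /bernoulli_pmf !onem_sigmoid.
  case: (y e); rewrite (le_trans (ln_sigmoid_lip _ _))//.
  by rewrite -opprD normrN.
by rewrite sumr_const -[leLHS]mulr_natl ler_wpM2r// ler_nat max_card.
Qed.

Context {d : measure_display} {T : measurableType d} (P : probability T R).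
Variables (gamma rho1 rho2 s eta t : R) (xstar : @param R N K dE dR).
Variables (Y Obs : edge N K -> {RV P >-> bool}) (xhat : T -> @param R N K dE dR).
Hypothesis gamma01 : 0 <= gamma <= 1.
Hypothesis (rho1_ge0 : 0 <= rho1) (rho2_ge0 : 0 <= rho2).
Hypothesis xstarU : Theta U xstar.
Hypothesis model : network_model phi gamma xstar Y Obs.
Hypothesis pmle : forall w, is_PMLE phi U rho1 rho2 (fun e => Y e w)
  (observed Obs w) (xhat w).
Hypothesis pen_le :
  rho1 * param_l1norm xstar + rho2 * param_enorm xstar ^+ 2 <= s.
Hypothesis eta_ge0 : 0 <= eta.
Variables (I : finType) (cell : @param R N K dE dR -> I).
Hypothesis cell_lip : forall x x', Theta U x -> Theta U x' ->
  cell x = cell x' ->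
  forall e, `|phi (at_edge x e) - phi (at_edge x' e)| <= eta.

Lemma param_l1norm_ge0 x : 0 <= param_l1norm x.
Proof. by rewrite addr_ge0// sumr_ge0// => i _; rewrite sumr_ge0. Qed.

Lemma pmle_loglik w : loglik phi (fun e => Y e w) (observed Obs w) xstar <=
  loglik phi (fun e => Y e w) (observed Obs w) (xhat w) + s.
Proof.
have [_ /(_ _ xstarU)] := pmle w; rewrite /penloglik.
have := mulr_ge0 rho1_ge0 (param_l1norm_ge0 (xhat w)).
have := mulr_ge0 rho2_ge0 (sqr_ge0 (param_enorm (xhat w))).
have := pen_le; lra.
Qed.

Lemma llr_loglik w x :
  llr (Mprob phi xstar) (Mprob phi x) [ffun e => (Y e w, Obs e w)] =
  loglik phi (fun e => Y e w) (observed Obs w) x -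
  loglik phi (fun e => Y e w) (observed Obs w) xstar.
Proof.
rewrite !loglikE -sumrB; apply: eq_big => e; first by rewrite ffunE inE.
by rewrite ffunE.
Qed.

Lemma sum_joint_llr_le x : Theta U x -> t <= KLloss phi x xstar ->
  \sum_z joint_pmf gamma (Mprob phi xstar) z *
    expR (llr (Mprob phi xstar) (Mprob phi x) z / 2) <=
  expR (- (gamma * #|edge N K|%:R * t / (2 * (2 + C)))).
Proof.
move=> hx ht.
apply: le_trans (sum_expR_half_llr_le gamma01 _ _ _) _.
- exact: Mprob_itv.
- exact: Mprob_itv.
- by move=> e; exact: affinity_Mprob_le1.
rewrite ler_expR mulNr lerN2 -!mulrA.
case/andP: gamma01 => g0 g1; rewrite ler_wpM2l// mulrA.
rewrite ler_pdivrMr; last by have := C1; lra.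
rewrite [leRHS]mulrC (le_trans _ (KLloss_le_affinity hx xstarU))//.
by rewrite mulrC ler_wpM2r.
Qed.

(* Union bound over the cells that meet the bad set [t <= KLloss x xstar], each
   represented by a bad point; at the representative of the cell of [xhat] the
   log-likelihood ratio is at least [- (s + #|edge| * eta)], and Markov's
   inequality is applied to its square root. *)
Lemma KLloss_tail : measurable [set w | t <= KLloss phi (xhat w) xstar] ->
  (P [set w | (t <= KLloss phi (xhat w) xstar)%R] <=
   (#|I|%:R * expR ((s + #|edge N K|%:R * eta) / 2 -
                    gamma * #|edge N K|%:R * t / (2 * (2 + C))))%:E)%E.
Proof.
move=> mE; pose n := #|edge N K|%:R : R.
pose bad c x := [/\ Theta U x, cell x = c & t <= KLloss phi x xstar].
have [rep repP] : {rep & forall c, (exists x, bad c x) -> bad c (rep c)}.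
  apply: (@choice _ _ (fun c r => (exists x, bad c x) -> bad c r)) => c.
  have [[x xc]|nc] := pselect (exists x, bad c x).
    by exists x.
  (* A cell without bad points gets a dummy representative. *)
  by exists xstar.
pose hit c := `[< exists x, bad c x >].
pose A : pred {ffun edge N K -> bool * bool} := fun z =>
  `[< exists2 w, t <= KLloss phi (xhat w) xstar &
                 z = [ffun e => (Y e w, Obs e w)] >].
have p01 e : 0 <= Mprob phi xstar e <= 1.
  by have /andP[/ltW-> /ltW->] := Mprob_itv xstar e.
apply: le_trans (measure_le_sum_joint (A := A) gamma01 p01 (Y_bernoulli model)
  (Y_independent model) (Obs_bernoulli model) (Obs_independent model)
  (Y_Obs_independent model) mE _) _.
  by move=> w tw; apply/asboolP; exists w.
rewrite lee_fin.
pose W z := joint_pmf gamma (Mprob phi xstar) z.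
have W0 z : 0 <= W z by apply: joint_pmf_ge0 => // e; exact: Mprob_itv.
pose f c z := expR (llr (Mprob phi xstar) (Mprob phi (rep c)) z / 2).
pose a := expR ((s + n * eta) / 2).
(* The term of the cell of [xhat w] alone is at least [W z], since the factor [a] makes up for the
   discretisation and the penalty; the other terms are nonnegative. *)
have Wle z : A z -> W z <= \sum_(c | hit c) a * (W z * f c z).
  move=> /asboolP[w tw ->].
  have xhatU : Theta U (xhat w) by have [] := pmle w.
  have [] := repP (cell (xhat w)); first by exists (xhat w).
  move=> repU repc rept.
  rewrite (bigD1 (cell (xhat w)))/=; last first.
    by apply/asboolP; exists (xhat w).
  apply: ler_wpDr; first by rewrite sumr_ge0// => c _; rewrite !mulr_ge0 ?expR_ge0.
  rewrite mulrCA ler_peMr// -expRD -[leLHS]expR0 ler_expR llr_loglik.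
  have := pmle_loglik w.
  have := loglik_lip (fun e => Y e w) (observed Obs w) eta_ge0
    (cell_lip xhatU repU (esym repc)).
  rewrite -/n; lra.
apply: (@le_trans _ _ (\sum_(z | A z) \sum_(c | hit c) a * (W z * f c z))).
  exact: ler_sum.
(* Summing over all outcomes turns each inner sum, after the exchange, into a full expectation under
   the true law. *)
apply: (@le_trans _ _ (\sum_z \sum_(c | hit c) a * (W z * f c z))).
  rewrite [leRHS](bigID A)/= ler_wpDr// sumr_ge0// => z _.
  by rewrite sumr_ge0// => c _; rewrite !mulr_ge0 ?expR_ge0.
rewrite exchange_big/=.
apply: (@le_trans _ _ (\sum_(c | hit c)
    a * expR (- (gamma * n * t / (2 * (2 + C)))))).
  apply: ler_sum => c /asboolP/repP[repU _ rept].
  by rewrite -mulr_sumr ler_wpM2l ?expR_ge0//; exact: sum_joint_llr_le.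
rewrite sumr_const -[leLHS]mulr_natl -expRD ler_wpM2r ?expR_ge0//.
by rewrite ler_nat max_card.
Qed.

End tail_bound.

(** * Discretisation of the parameter space by a coordinate grid *)

Lemma sqr_le_of_norm_le {R : realDomainType} (b c : R) : `|c| <= b ->
  c ^+ 2 <= b ^+ 2.
Proof. by rewrite ler_norml => /andP[]; nra. Qed.

Section covering.
Context {R : realType} {N K dE dR : nat}.
Variables (phi : 'rV[R]_(dE + dE + dR) -> R) (U alpha h : R).
Hypotheses (U_gt0 : 0 < U) (h_gt0 : 0 < h).
Hypothesis phi_lip : forall u v, triples U u -> triples U v ->
  `|phi u - phi v| <= alpha * enorm (u - v).
Implicit Types x : @param R N K dE dR.

Lemma eball_coord k (u : 'rV[R]_k) j : eball U u -> `|u ord0 j| <= U.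
Proof.
rewrite /eball/= => hu; apply: le_trans hu.
rewrite -sqrtr_sqr ler_wsqrtr// (bigD1 j)//= lerDl sumr_ge0// => i _.
exact: sqr_ge0.
Qed.

(** The factor [k] replaces the sharper root of [k], using [k <= k ^ 2]. *)
Lemma enorm_le_coord k (u : 'rV[R]_k) : (forall j, `|u ord0 j| <= h) ->
  enorm u <= k%:R * h.
Proof.
move=> hu; have kh0 : 0 <= k%:R * h by rewrite mulr_ge0// ltW.
rewrite -(ger0_norm kh0) -sqrtr_sqr ler_wsqrtr//.
apply: (@le_trans _ _ (\sum_(j < k) h ^+ 2)).
  by apply: ler_sum => j _; exact: sqr_le_of_norm_le.
rewrite sumr_const card_ord -[leLHS]mulr_natl exprMn ler_wpM2r ?sqr_ge0//.
by rewrite -natrX ler_nat; case: k {u hu kh0} => // k; rewrite expnS expn1 leq_pmull.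
Qed.

(** The largest index along one coordinate: [(c + U) / h] ranges over [[0, 2 * U / h]], so
    truncation takes [grid.+1] values. *)
Definition grid : nat := Num.truncn (2 * U / h).

Definition grid_index (c : R) : 'I_grid.+1 := inord (Num.truncn ((c + U) / h)).

(** Rescaled coordinates with the same integer part differ by less than [1]; [inord] is faithful as
    these integer parts are at most [grid]. *)
Lemma grid_indexP c c' : `|c| <= U -> `|c'| <= U ->
  grid_index c = grid_index c' -> `|c - c'| <= h.
Proof.
have itv (a : R) : `|a| <= U -> 0 <= (a + U) / h <= 2 * U / h.
  rewrite ler_norml => /andP[a1 a2]; apply/andP; split.
    by apply: divr_ge0; [lra|exact: ltW].
  by rewrite ler_pM2r ?invr_gt0//; lra.
move=> /itv/andP[c0 cU] /itv/andP[c0' cU'] /(congr1 val).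
rewrite /= !inordK ?ltnS ?le_truncn// => e.
have /andP[a1 a2] := truncn_itv c0; have /andP[b1 b2] := truncn_itv c0'.
move: a1 a2 b1 b2; rewrite e -natr1 => a1 a2 b1 b2.
have -> : c - c' = ((c + U) / h - (c' + U) / h) * h.
  by field; rewrite gt_eqF.
by rewrite normrM (gtr0_norm h_gt0) ger_pMl// ler_norml; lra.
Qed.

Definition grid_cell x :
    {ffun 'I_N * 'I_dE -> 'I_grid.+1} * {ffun 'I_K * 'I_dR -> 'I_grid.+1} :=
  ([ffun a => grid_index (theta x a.1 ord0 a.2)],
   [ffun a => grid_index (relw x a.1 ord0 a.2)]).

Lemma grid_cellP x x' : Theta U x -> Theta U x' ->
  grid_cell x = grid_cell x' -> forall e j,
  `|(at_edge x e - at_edge x' e) ord0 j| <= h.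
Proof.
move=> [xE xR] [xE' xR'] [/ffunP eqE /ffunP eqR] e j.
have hE i k : `|theta x i ord0 k - theta x' i ord0 k| <= h.
  apply: grid_indexP; [exact: eball_coord|exact: eball_coord|].
  by have := eqE (i, k); rewrite !ffunE.
have hR i k : `|relw x i ord0 k - relw x' i ord0 k| <= h.
  apply: grid_indexP; [exact: eball_coord|exact: eball_coord|].
  by have := eqR (i, k); rewrite !ffunE.
rewrite mxE [X in _ + X]mxE /at_edge.
case: (split_ordP j) => {}j ->; last by rewrite !row_mxEr.
by rewrite !row_mxEl; case: (split_ordP j) => {}j ->; rewrite ?row_mxEl ?row_mxEr.
Qed.

Lemma grid_cell_lip x x' : Theta U x -> Theta U x' ->
  grid_cell x = grid_cell x' -> forall e,
  `|phi (at_edge x e) - phi (at_edge x' e)| <=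
  `|alpha| * ((dE + dE + dR)%:R * h).
Proof.
move=> hx hx' xx' e.
apply: le_trans (phi_lip (triples_at_edge e hx) (triples_at_edge e hx')) _.
apply: le_trans (ler_wpM2r _ (ler_norm alpha)) _; first exact: sqrtr_ge0.
by rewrite ler_wpM2l// enorm_le_coord//; exact: grid_cellP.
Qed.

Lemma card_grid_cell :
  #|{: {ffun 'I_N * 'I_dE -> 'I_grid.+1} * {ffun 'I_K * 'I_dR -> 'I_grid.+1}}|
  = (grid.+1 ^ num_params K dE dR N)%N.
Proof. by rewrite card_prod !card_ffun !card_prod !card_ord -expnD. Qed.

Lemma penalty_le (rho1 rho2 : R) x : 0 <= rho1 -> 0 <= rho2 -> Theta U x ->
  rho1 * param_l1norm x + rho2 * param_enorm x ^+ 2 <=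
  (rho1 + rho2) * (U + U ^+ 2) * (num_params K dE dR N)%:R.
Proof.
move=> r1 r2 [xE xR]; set m := (num_params K dE dR N)%:R : R.
have mE : m = N%:R * dE%:R + K%:R * dR%:R by rewrite /m natrD !natrM.
have sum_le n k (f : 'I_n -> 'rV[R]_k) (F : R -> R) b :
    (forall i, eball U (f i)) -> (forall c, `|c| <= U -> F c <= b) ->
    \sum_i \sum_j F (f i ord0 j) <= n%:R * k%:R * b.
  move=> fU Fb; apply: (@le_trans _ _ (\sum_(i < n) \sum_(j < k) b)).
    apply: ler_sum => i _; apply: ler_sum => j _; apply: Fb.
    exact: eball_coord.
  by rewrite !sumr_const !card_ord -mulrnA -[leLHS]mulr_natl natrM [k%:R * _]mulrC.
have h1 : param_l1norm x <= m * U.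
  by rewrite mE mulrDl lerD//; apply: (sum_le _ _ _ Num.norm).
have enorm_sqr k (u : 'rV[R]_k) : enorm u ^+ 2 = \sum_j u ord0 j ^+ 2.
  by rewrite sqr_sqrtr// sumr_ge0// => j _; exact: sqr_ge0.
have h2 : param_enorm x ^+ 2 <= m * U ^+ 2.
  rewrite sqr_sqrtr ?addr_ge0 ?sumr_ge0// => [|i _|i _]; try exact: sqr_ge0.
  rewrite mE mulrDl lerD//.
    by under eq_bigr do rewrite enorm_sqr; apply: (sum_le _ _ _ (fun c => c ^+ 2)) => // c; exact: sqr_le_of_norm_le.
  by under eq_bigr do rewrite enorm_sqr; apply: (sum_le _ _ _ (fun c => c ^+ 2)) => // c; exact: sqr_le_of_norm_le.
have m0 : 0 <= m by [].
have a1 := ler_wpM2l r1 h1; have a2 := ler_wpM2l r2 h2.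
(* The nonnegative cross terms [rho1 * m * U ^+ 2] and [rho2 * m * U] are added to reach the common
   factor [U + U ^+ 2]. *)
have := mulr_ge0 r1 (mulr_ge0 m0 (sqr_ge0 U)).
have := mulr_ge0 r2 (mulr_ge0 m0 (ltW U_gt0)).
lra.
Qed.

End covering.

(** * Explicit exponential tail bound for fixed [N] *)

Section nonasymptotic_bound.
Context {R : realType} {N K dE dR : nat}.
Variables (phi : 'rV[R]_(dE + dE + dR) -> R) (U C alpha : R).
Hypotheses (U_gt0 : 0 < U) (C_ge2 : 2 <= C).
Hypothesis phi_lip : forall u v, triples U u -> triples U v ->
  `|phi u - phi v| <= alpha * enorm (u - v).

(** The supremum is an upper bound once the set is known to be bounded above; comparison with the
    value at the origin through the Lipschitz condition shows this. *)
Lemma norm_phi_le_sup : C = sup [set `|phi u| | u in triples U] ->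
  forall u, triples U u -> `|phi u| <= C.
Proof.
move=> -> u hu; apply: ub_le_sup; last by exists u.
pose u0 : 'rV[R]_(dE + dE + dR) := row_mx (row_mx 0 0) 0.
have ball0 k : eball U (0 : 'rV[R]_k).
  by rewrite /eball/= /enorm big1 ?sqrtr0 ?ltW// => j _; rewrite mxE expr0n.
have hu0 : triples U u0 by exists 0, 0, 0.
exists (`|phi u0| + `|alpha| * ((dE + dE + dR)%:R * U)) => _ [v hv <-].
rewrite -[phi v](subrK (phi u0)) addrC (le_trans (ler_normD _ _))// lerD2l.
apply: le_trans (phi_lip hv hu0) _.
apply: le_trans (ler_wpM2r _ (ler_norm alpha)) _; first exact: sqrtr_ge0.
rewrite ler_wpM2l// enorm_le_coord// => j.
rewrite mxE [X in _ + X]mxE /u0; case: hv => a [b [c [ha hb hc ->]]].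
case: (split_ordP j) => {}j ->; last first.
  by rewrite !row_mxEr mxE oppr0 addr0 eball_coord.
rewrite !row_mxEl; case: (split_ordP j) => {}j ->.
  by rewrite !row_mxEl mxE oppr0 addr0 eball_coord.
by rewrite !row_mxEr mxE oppr0 addr0 eball_coord.
Qed.

Context {d : measure_display} {T : measurableType d} (P : probability T R).
Variables (gamma rho1 rho2 t : R) (xstar : @param R N K dE dR).
Variables (Y Obs : edge N K -> {RV P >-> bool})
  (xhat : T -> @param R N K dE dR).
Hypothesis hdim : (0 < dE + dR)%N.
Hypothesis gamma01 : 0 < gamma <= 1.
Hypothesis (rho1_ge0 : 0 <= rho1) (rho2_ge0 : 0 <= rho2).
Hypothesis phi_le : forall u, triples U u -> `|phi u| <= C.
Hypothesis xstarU : Theta U xstar.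
Hypothesis model : network_model phi gamma xstar Y Obs.
Hypothesis pmle : forall w, is_PMLE phi U rho1 rho2 (fun e => Y e w)
  (observed Obs w) (xhat w).
Hypothesis t_ge0 : 0 <= t.

Let n : R := eff_sample_size gamma K N.
Let m : R := (num_params K dE dR N)%:R.

Definition covering_const : R :=
  2 * U * (`|alpha| + 1) * (dE + dE + dR)%:R / gamma + 1.

Lemma covering_const_ge1 : 1 <= covering_const.
Proof.
case/andP: gamma01 => g0 _.
by rewrite lerDr divr_ge0 ?mulr_ge0 ?addr_ge0 ?(ltW U_gt0) ?(ltW g0).
Qed.

(* The mesh [h] makes the discretisation error of the log-likelihood at most
   [m], while the grid has at most [covering_const * (n / m)] points per
   coordinate. *)
Lemma KLloss_tail_exp : 1 <= m -> m <= n ->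
  measurable [set w | t <= KLloss phi (xhat w) xstar] ->
  (P [set w | (t <= KLloss phi (xhat w) xstar)%R] <=
   (expR (m * (ln covering_const + ln (n / m) + 2^-1 +
               (rho1 + rho2) * (U + U ^+ 2) / 2) - n * t / (4 * C)))%:E)%E.
Proof.
move=> m1 mn mE; case/andP: gamma01 => g0 g1.
have m0 : 0 < m by apply: lt_le_trans m1.
have n0 : 0 < n by apply: lt_le_trans mn.
(* Adding [1] keeps the denominator of [h] positive when [alpha] is [0], while the ratio of
   [|alpha|] to [kappa] stays at most [1]. *)
pose kappa := `|alpha| + 1.
have kappa0 : 0 < kappa by rewrite ltr_wpDl.
pose D := (dE + dE + dR)%:R : R.
have D0 : 0 < D by rewrite ltr0n -addnA addn_gt0 hdim orbT.
pose h := gamma * m / (n * kappa * D).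
have nkD0 : 0 < n * kappa * D by apply: mulr_gt0 => //; exact: mulr_gt0.
have h0 : 0 < h by apply: divr_gt0 => //; exact: mulr_gt0.
have gamma01' : 0 <= gamma <= 1 by rewrite (ltW g0).
have C1 : 1 <= C by have := C_ge2; lra.
have eta0 : 0 <= `|alpha| * (D * h) by rewrite mulr_ge0 ?normr_ge0 ?(ltW (mulr_gt0 D0 h0)).
have edgeE : n = gamma * #|edge N K|%:R.
  by rewrite /n /eff_sample_size /edge !card_prod !card_ord !natrM; ring.
have := KLloss_tail C1 phi_le gamma01' rho1_ge0 rho2_ge0 xstarU model pmle
  (penalty_le U_gt0 rho1_ge0 rho2_ge0 xstarU) eta0
  (grid_cell_lip h0 phi_lip) mE.
move/le_trans; apply; rewrite lee_fin card_grid_cell -edgeE.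
set M := num_params K dE dR N.
(* The term [2 * U / h] gives the first summand of [covering_const]; the one extra cell is absorbed
   by [1 <= n / m]. *)
have grid_le : (grid U h).+1%:R <= covering_const * (n / m).
  have U2h : 0 <= 2 * U / h by rewrite divr_ge0 ?(ltW h0)// mulr_ge0 ?(ltW U_gt0).
  have /andP[gr _] := truncn_itv U2h.
  rewrite -natr1 /covering_const mulrDl mul1r lerD//; last first.
    by rewrite ler_pdivlMr// mul1r.
  apply: le_trans gr _; rewrite /h -/D -/kappa le_eqVlt; apply/orP; left.
  by apply/eqP; field; rewrite -!natrD !lt0r_neq0.
have r0 : 0 < n / m by rewrite divr_gt0.
have B0 : 0 < covering_const by apply: lt_le_trans covering_const_ge1.
have gridn : ((grid U h).+1 ^ M)%:R <= expR (m * (ln covering_const + ln (n / m))).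
  rewrite natrX /m expRM_natl -lnM ?posrE// lnK; last by rewrite posrE mulr_gt0.
  by apply: lerXn2r; rewrite ?nnegrE ?(ltW (mulr_gt0 B0 r0)).
apply: le_trans (ler_wpM2r (expR_ge0 _) gridn) _.
rewrite -expRD ler_expR.
have c0 : 0 < #|edge N K|%:R :> R by rewrite -(pmulr_rgt0 _ g0) -edgeE.
have disc : #|edge N K|%:R * (`|alpha| * (D * h)) <= m.
  have -> : #|edge N K|%:R * (`|alpha| * (D * h)) = m * (`|alpha| / kappa).
    rewrite /h edgeE; move: #|edge N K|%:R c0 => c c0.
    by field; rewrite -?natrD !lt0r_neq0.
  by rewrite ler_piMr ?(ltW m0)// ler_pdivrMr// mul1r lerDl.
have rate : n * t / (4 * C) <= n * t / (2 * (2 + C)).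
  have nt0 : 0 <= n * t by rewrite mulr_ge0// ltW.
  by rewrite ler_wpM2l// lef_pV2 ?posrE; have := C_ge2; lra.
rewrite -/m; lra.
Qed.

End nonasymptotic_bound.

(** * Eventual bounds, asymptotic comparison and truncated expectation *)

Section limits.
Context {R : realType}.
Implicit Types (a : nat -> \bar R) (b : nat -> R) (u : (\bar R)^nat).

Lemma near_le_ln (A : R) : \forall N \near \oo, A <= ln N%:R.
Proof.
near=> N.
have AN : expR A <= N%:R by near: N; exact: nbhs_infty_ger.
have N0 : 0 < N%:R :> R by apply: lt_le_trans AN; exact: expR_gt0.
by rewrite -[leLHS]expRK ler_ln// posrE expR_gt0.
Unshelve. all: by end_near. Qed.

(** With [s] the root of [r], [ln r = 2 * ln s <= 2 * s], and [2 <= e * s] by the threshold on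
    [r]. *)
Lemma ln_le_mul (e r : R) : 0 < e -> (2 / e) ^+ 2 <= r -> ln r <= e * r.
Proof.
move=> e0 er; have q0 : 0 < 2 / e by rewrite divr_gt0.
have r0 : 0 < r by apply: lt_le_trans er; rewrite exprn_gt0.
have s0 : 0 < Num.sqrt r by rewrite sqrtr_gt0.
have rs : r = Num.sqrt r ^+ 2 by rewrite sqr_sqrtr// ltW.
have qs : 2 / e <= Num.sqrt r.
  by rewrite -(ger0_norm (ltW q0)) -sqrtr_sqr ler_wsqrtr.
have es : 2 <= Num.sqrt r * e by rewrite -ler_pdivrMr.
rewrite {1}rs lnXn// -mulr_natl.
have := ln_sublinear s0; nra.
Qed.

Lemma limn_esup_le_near u (x : \bar R) :
  (\forall N \near \oo, (u N <= x)%E) -> (limn_esup u <= x)%E.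
Proof.
move=> [N0 _ h]; apply: (@le_trans _ _ (ereal_sup (u @` [set N | (N0 <= N)%N]))).
  by apply: ereal_inf_lbound; exists [set N | (N0 <= N)%N] => //; exists N0.
by apply: ge_ereal_sup => _ [N hN <-]; exact: h.
Qed.

(** Division by the negative [b N] reverses the inequality; if [a N] is [-oo], the ratio is [+oo]
    and the bound still holds. *)
Lemma lesssim_neg_near a b :
  (\forall N \near \oo, b N < 0 /\ (a N <= (b N)%:E)%E) -> lesssim_neg a b.
Proof.
move=> h; rewrite /lesssim_neg /limn_einf leeNr; apply: limn_esup_le_near.
apply: filterS h => N [b0 ab]; rewrite leeN2.
case: (a N) ab => [x| |].
- by rewrite lee_fin -EFinM lee_fin => xb; rewrite ler_ndivlMr// mul1r.
- by rewrite leye_eq.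
- by move=> _; rewrite lt0_mulNye ?leey// lte_fin invr_lt0.
Qed.

Lemma lesssim_pos_near a b :
  (forall e, 0 < e -> \forall N \near \oo,
     0 < b N /\ (a N <= ((1 + e) * b N)%:E)%E) -> lesssim_pos a b.
Proof.
move=> h; apply/lee_addgt0Pr => e e0; apply: limn_esup_le_near.
apply: filterS (h e e0) => N [b0 ab].
by rewrite lee_pdivrMr// -EFinD -EFinM.
Qed.

Lemma lne_le_expR (x : \bar R) (e : R) :
  (0 <= x)%E -> (x <= (expR e)%:E)%E -> (lne x <= e%:E)%E.
Proof.
move=> x0 xe; rewrite -[X in (_ <= X%:E)%E]expRK -lne_EFin ?expR_gt0//.
by rewrite lee_lne// in_itv/= ?x0 ?leey// lee_fin expR_ge0.
Qed.

(** The integral is split at the level [t]: the integrand is at most [t] below it and at most [M]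
    above it. *)
Lemma expectation_le_tail d (T : measurableType d) (P : probability T R)
    (X : T -> R) (t M : R) : measurable_fun [set: T] X ->
  (forall w, 0 <= X w <= M) -> 0 <= t ->
  ('E_P[X] <= t%:E + M%:E * P [set w | (t <= X w)%R])%E.
Proof.
move=> mX X0M t0.
have mE : measurable [set w | t <= X w].
  by rewrite -[X in measurable X]setTI; exact: measurable_fun_le.
have mX' D : measurable D -> measurable_fun D (fun w => (X w)%:E).
  by move=> mD; apply/measurable_EFinP; exact: measurable_funTS.
rewrite unlock -(setUv [set w | t <= X w]) ge0_integral_setU//=; first last.
- by apply/disj_setPCl.
- by move=> w _; rewrite lee_fin; have /andP[] := X0M w.
- by apply: mX'; rewrite setUv.
- exact: measurableC.
rewrite addeC; apply: leeD.
  apply: (@le_trans _ _ (\int[P]_(w in ~` [set w | (t <= X w)%R]) t%:E)%E).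
    apply: ge0_le_integral => //.
    - exact: measurableC.
    - by move=> w _; rewrite lee_fin; have /andP[] := X0M w.
    - by apply: mX'; exact: measurableC.
    - by move=> w /= /negP; rewrite -ltNge lee_fin => /ltW.
  rewrite integral_cst; last exact: measurableC.
  rewrite -[leRHS]mule1 lee_wpmul2l// ?lee_fin// probability_le1//.
  exact: measurableC.
apply: (@le_trans _ _ (\int[P]_(w in [set w | (t <= X w)%R]) M%:E)%E).
  apply: ge0_le_integral => //.
  - by move=> w _; rewrite lee_fin; have /andP[] := X0M w.
  - exact: mX'.
  - by move=> w _; rewrite lee_fin; have /andP[] := X0M w.
by rewrite integral_cst.
Qed.

End limits.

(** * Growth of the ratio of sample size to number of parameters *)

Section dimensions.
Context {R : realType} (K dE dR : nat) (gamma : R).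
Hypotheses (K_gt0 : (0 < K)%N) (hdim : (0 < dE + dR)%N) (gamma_gt0 : 0 < gamma).

Let n N : R := eff_sample_size gamma K N.
Let m N : R := (num_params K dE dR N)%:R.

Lemma eff_sample_size_gt0 N : (0 < N)%N -> 0 < n N.
Proof.
by move=> N0; rewrite !mulr_gt0// ?exprn_gt0 ?ltr0n.
Qed.

Lemma num_params_gt0 N : (0 < N)%N -> (0 < num_params K dE dR N)%N.
Proof.
move=> N0; rewrite addn_gt0 !muln_gt0 N0 K_gt0.
by move: hdim; rewrite addn_gt0.
Qed.

(** A lower bound for [n / m] per entity: [m <= N * (dE + K * dR)] as soon as [1 <= N]. *)
Definition ratio_const : R := gamma * K%:R / (dE + K * dR)%:R.

Lemma params_coef_gt0 : 0 < (dE + K * dR)%:R :> R.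
Proof.
rewrite ltr0n addn_gt0 muln_gt0 K_gt0.
by move: hdim; rewrite addn_gt0.
Qed.

Lemma ratio_const_gt0 : 0 < ratio_const.
Proof. by rewrite divr_gt0 ?params_coef_gt0// mulr_gt0// ltr0n. Qed.

Lemma ratio_ge N : (0 < N)%N -> ratio_const * N%:R <= n N / m N.
Proof.
move=> N0; rewrite ler_pdivlMr ?ltr0n ?num_params_gt0//.
have mN : m N <= N%:R * (dE + K * dR)%:R.
  by rewrite /m -natrM ler_nat mulnDr leq_add2l mulnA leq_mul// leq_pmull.
apply: (@le_trans _ _ (ratio_const * N%:R * (N%:R * (dE + K * dR)%:R))).
  by rewrite ler_wpM2l// mulr_ge0// ltW// ratio_const_gt0.
have := params_coef_gt0; rewrite /ratio_const /n /eff_sample_size.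
move: (_ + _)%:R => q q0; rewrite le_eqVlt; apply/orP; left.
by apply/eqP; field; rewrite gt_eqF.
Qed.

Lemma near_le_ln_ratio (A : R) : \forall N \near \oo, A <= ln (n N / m N).
Proof.
near=> N.
have N0 : (0 < N)%N by near: N; exact: nbhs_infty_gt.
have h : A - ln ratio_const <= ln N%:R by near: N; exact: near_le_ln.
have NR : 0 < N%:R :> R by rewrite ltr0n.
have c0 := ratio_const_gt0.
apply: (@le_trans _ _ (ln (ratio_const * N%:R))).
  by rewrite lnM ?posrE// -lerBlDl.
have cN := ratio_ge N0.
by rewrite ler_ln ?posrE// ?(lt_le_trans _ cN)// mulr_gt0.
Unshelve. all: by end_near. Qed.

End dimensions.

(** * Asymptotic tails at fixed and vanishing levels, and the expected loss *)

Theorem theorem3 (R : realType) (K dE dR : nat) (C U alpha gamma : R)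
  (hK : (0 < K)%N) (hdim : (0 < dE + dR)%N) (hU : 0 < U)
  (hgamma : 0 < gamma <= 1) (hC : 2 <= C)
  (phi : nat -> 'rV[R]_(dE + dE + dR) -> R)
  (hsup : forall N, C = sup [set `|phi N u| | u in triples U])
  (hlip : forall N u v, triples U u -> triples U v ->
     `|phi N u - phi N v| <= alpha * enorm (u - v))
  (rho1 rho2 : nat -> R)
  (hrho1 : forall N, 0 <= rho1 N) (hrho2 : forall N, 0 <= rho2 N)
  (hrho : (fun N => rho1 N + rho2 N : R^o) =o_\oo (fun N => ln N%:R : R^o))
  (xstar : forall N, param N K dE dR)
  (hxstar : forall N, Theta U (xstar N))
  (d : nat -> measure_display) (T : forall N, measurableType (d N))
  (P : forall N, probability (T N) R)
  (Y Obs : forall N, edge N K -> {RV P N >-> bool})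
  (hmodel : forall N, network_model (phi N) gamma (xstar N) (Y N) (Obs N))
  (xhat : forall N, T N -> param N K dE dR)
  (hxhat : forall N (w : T N),
     is_PMLE (phi N) U (rho1 N) (rho2 N) (fun e => Y N e w) (observed (Obs N) w)
             (xhat N w))
  (hmeas : forall N,
     measurable_fun [set: T N] (fun w => KLloss (phi N) (xhat N w) (xstar N))) :
  let L N (w : T N) := KLloss (phi N) (xhat N w) (xstar N) in
  let n N : R := eff_sample_size gamma K N in
  let m N : R := (num_params K dE dR N)%:R in
  [/\ forall t : R, 0 < t ->
        lesssim_neg (fun N => lne (P N [set w | t <= L N w]))
                    (fun N => - (t / (5 * C)) * n N),
      let t N : R := 10 * C * (m N / n N) * ln (n N / m N) in
        lesssim_neg (fun N => lne (P N [set w | t N <= L N w]))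
                    (fun N => - (m N * ln (n N / m N)))
    & lesssim_pos (fun N => 'E_(P N)[L N])%E
                  (fun N => 10 * C * (m N / n N) * ln (n N / m N))].
Proof.
move=> L n m; have /andP[g0 g1] := hgamma.
have C0 : 0 < C by lra.
have phi_le N := norm_phi_le_sup hU (@hlip N) (hsup N).
have mE N t : measurable [set w | t <= L N w].
  by rewrite -[X in measurable X]setTI; exact: measurable_fun_le.
pose B := @covering_const R dE dR U alpha gamma.
pose c := ratio_const K dE dR gamma.
pose V := U + U ^+ 2.
have V0 : 0 < V by rewrite addr_gt0// exprn_gt0.
have c0 : 0 < c by exact: ratio_const_gt0.
have ln_ratio A := near_le_ln_ratio hK hdim g0 A.
(* The bound is uniform in [t] at each such [N], since in (ii) and (iii) the level varies with
   [N]. *)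
pose tail_at N := [/\ 1 <= m N, 0 < n N, 1 < n N / m N &
    forall t, 0 <= t -> (P N [set w | (t <= L N w)%R] <=
      (expR (3 / 2 * m N * ln (n N / m N) - n N * t / (4 * C)))%:E)%E].
have tail : \forall N \near \oo, tail_at N.
  near=> N.
  have N0 : (0 < N)%N by near: N; exact: nbhs_infty_gt.
  have m1 : 1 <= m N by rewrite ler1n num_params_gt0.
  have n0 : 0 < n N by exact: eff_sample_size_gt0.
  have m0 : 0 < m N by lra.
  have r0 : 0 < n N / m N by exact: divr_gt0.
  have r1 : 1 < n N / m N.
    have : 1 <= ln (n N / m N) by near: N; exact: ln_ratio.
    by have := ln_sublinear r0; lra.
  split => // t t0.
  apply: le_trans (KLloss_tail_exp hU hC (@hlip N) hdim hgamma (hrho1 N)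
    (hrho2 N) (@phi_le N) (hxstar N) (hmodel N) (@hxhat N) t0 m1 _ (mE N t)) _.
    by move: r1; rewrite ltr_pdivlMr// mul1r => /ltW.
  rewrite lee_fin ler_expR -/B -/(n N) -/(m N) -/V lerD2r.
  rewrite [3 / 2 * _]mulrC -[leRHS]mulrA ler_pM2l//.
  (* The constant in the little-o is chosen so that the penalty costs at most [ln N / 8] per
     parameter. *)
  have rhoN : rho1 N + rho2 N <= (4 * V)^-1 * ln N%:R.
    have lnN : 0 <= ln N%:R :> R by rewrite ln_ge0// ler1n.
    rewrite -[X in _ * X](ger0_norm lnN); apply: le_trans (ler_norm _) _.
    near: N; move/eqoP: hrho; apply; rewrite invr_gt0 mulr_gt0//.
  have lnN : ln N%:R <= ln (n N / m N) - ln c.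
    have NR : 0 < N%:R :> R by rewrite ltr0n.
    have cN := ratio_ge hK hdim g0 N0.
    rewrite lerBrDl -lnM ?posrE// ler_ln ?posrE// mulr_gt0//.
  have pen : (rho1 N + rho2 N) * V / 2 <= (ln (n N / m N) - ln c) / 8.
    have := ler_wpM2r (ltW V0) rhoN.
    rewrite (_ : (4 * V)^-1 * ln N%:R * V = ln N%:R / 4); first lra.
    by field; rewrite gt_eqF.
  (* Of the extra [ln (n / m) / 2] in the target, the penalty takes an eighth of [ln (n / m)]; the
     remaining [3/8] must cover the constants. *)
  have : 8 / 3 * (ln B + 2^-1 - ln c / 8) <= ln (n N / m N).
    by near: N; exact: ln_ratio.
  lra.
split.
- move=> t t0; apply: lesssim_neg_near; near=> N.
  have [m1 n0 r1 tailN] : tail_at N by near: N; exact: tail.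
  have m0 : 0 < m N by lra.
  have tC : 0 < t / (5 * C) by rewrite divr_gt0// mulr_gt0.
  split; first by rewrite mulNr oppr_lt0 mulr_gt0.
  apply: lne_le_expR; first exact: measure_ge0.
  apply: le_trans (tailN t (ltW t0)) _; rewrite lee_fin ler_expR.
  (* The value solves [3/2 * e = t / (4 * C) - t / (5 * C)]. *)
  have e0 : 0 < t / (30 * C) by rewrite divr_gt0// mulr_gt0.
  have rA : (2 / (t / (30 * C))) ^+ 2 <= n N / m N.
    apply: le_trans (ltW (ln_sublinear _)); last by rewrite divr_gt0.
    by near: N; exact: ln_ratio.
  have := ler_wpM2l (ltW m0) (ln_le_mul e0 rA).
  rewrite (_ : m N * (t / (30 * C) * (n N / m N)) = n N * t / (30 * C)); last first.
    by field; rewrite !gt_eqF.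
  rewrite (_ : - (t / (5 * C)) * n N =
    3 / 2 * (n N * t / (30 * C)) - n N * t / (4 * C)); first by lra.
  by field; rewrite gt_eqF.
- move=> t; apply: lesssim_neg_near; near=> N.
  have [m1 n0 r1 tailN] : tail_at N by near: N; exact: tail.
  have m0 : 0 < m N by lra.
  have lr0 : 0 < ln (n N / m N) by exact: ln_gt0.
  split; first by rewrite oppr_lt0 mulr_gt0.
  apply: lne_le_expR; first exact: measure_ge0.
  have t0 : 0 <= t N.
    exact/ltW/(mulr_gt0 (mulr_gt0 (mulr_gt0 _ C0) (divr_gt0 m0 n0)) lr0).
  apply: le_trans (tailN _ t0) _; rewrite lee_fin ler_expR le_eqVlt.
  (* Here [n * t / (4 * C)] equals [5/2 * m * ln (n / m)]. *)
  apply/orP; left; apply/eqP; rewrite /t.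
  by field; rewrite !gt_eqF.
- apply: lesssim_pos_near => e e0; near=> N.
  have [m1 n0 r1 tailN] : tail_at N by near: N; exact: tail.
  have m0 : 0 < m N by lra.
  have lr0 : 0 < ln (n N / m N) by exact: ln_gt0.
  set t := 10 * C * (m N / n N) * ln (n N / m N).
  have t0 : 0 < t.
    exact: (mulr_gt0 (mulr_gt0 (mulr_gt0 _ C0) (divr_gt0 m0 n0)) lr0).
  split => //.
  have L2C w : 0 <= L N w <= 2 * C.
    have [hatU _] := hxhat N w.
    by rewrite KLloss_ge0/= (KLloss_le _ (@phi_le N))//; lra.
  apply: le_trans (expectation_le_tail (P N) (hmeas N) L2C (ltW t0)) _.
  apply: le_trans (leeD2l _ (lee_wpmul2l _ (tailN _ (ltW t0)))) _.
    by rewrite lee_fin mulr_ge0// ltW.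
  rewrite -EFinM -EFinD lee_fin [leRHS]mulrDl mul1r lerD2l.
  (* As [1 <= m], the tail probability [expR (- (m * ln (n / m)))] is at most [m / n]. *)
  apply: (@le_trans _ _ (2 * C * (n N / m N)^-1)).
    rewrite ler_wpM2l ?mulr_ge0 ?(ltW C0)//.
    rewrite -[leRHS]lnK ?posrE ?invr_gt0 ?divr_gt0// ler_expR lnV ?posrE ?divr_gt0//.
    rewrite (_ : 3 / 2 * m N * ln (n N / m N) - n N * t / (4 * C) =
      - (m N * ln (n N / m N))); last first.
      by rewrite /t; field; rewrite !gt_eqF.
    by rewrite lerN2 ler_peMl// ltW.
  (* The remainder [2 * C * (m / n)] is at most [e * t] exactly when [1 <= 5 * e * ln (n / m)]. *)
  have : 1 / (5 * e) <= ln (n N / m N) by near: N; exact: ln_ratio.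
  rewrite ler_pdivrMr ?mulr_gt0// => h.
  rewrite invf_div /t.
  have q0 : 0 <= C * (m N / n N) by rewrite mulr_ge0 ?(ltW C0)// ltW// divr_gt0.
  by have := ler_wpM2l q0 h; lra.
Unshelve. all: by end_near. Qed.
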